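(* Let $E\subseteq M$ be star-shaped at $x_0\in E$ and let $f:E\to\mathbb{I}$, $f(x)=\langle f^c(x),f^w(x)\rangle$, be an interval-valued function. Let $\gamma:I\to M$, with $0\in I$ and $\gamma(I)\subseteq E$, be a geodesic with $\gamma(0)=x_0$ and $\dot\gamma(0)=X_{x_0}$ such that $(f^w\circ\gamma)(s)$ is non-decreasing for $s\in I\cap[0,\infty)$. If $f$ is cw-convex at $x_0$, then: (i) for fixed $X_{x_0}\in T_{x_0}(E)$, the function $Q:I\cap(0,\infty)\to\mathbb{I}$ defined by $$Q(s)=\frac{f(\gamma(s))\ominus_{gH}f(x_0)}{s}$$ is non-decreasing with respect to the order $\leq^{\min}$; (ii) if $Df(x_0;X_{x_0})$ exists, then (a) $Df(x_0;X_{x_0})=\lim_{s\to0^+}Q(s)=\langle Df^c(x_0;X_{x_0}),\,Df^w(x_0;X_{x_0})\rangle$, where $Df^w(x_0;X_{x_0})\ge 0$; (b) the interval-valued function $h(X_{x_0})=Df(x_0;X_{x_0})$, defined on $T_{x_0}(E)$, is positively homogeneous, i.e. $h(\lambda X_{x_0})=\lambda h(X_{x_0})$ for all $\lambda\ge 0$.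
   Context: Throughout, $(M,g)$ is a complete finite-dimensional Riemannian manifold with its Riemannian connection. $\mathbb{I}$ is the set of closed bounded intervals of $\mathbb{R}$. An interval $A=[a^l,a^u]$ is also written $A=\langle a^c,a^w\rangle$ with center $a^c=\frac{a^l+a^u}{2}$ and half-width $a^w=\frac{a^u-a^l}{2}$. For $k\ge 0$, $kA=[ka^l,ka^u]$; for $k<0$, $kA=[ka^u,ka^l]$. The generalized Hukuhara (gH) difference is $A\ominus_{gH}B=[\min\{a^l-b^l,a^u-b^u\},\max\{a^l-b^l,a^u-b^u\}]$. Limits of interval-valued functions are taken with respect to the Hausdorff distance $d_H(A,B)=\max\{|a^l-b^l|,|a^u-b^u|\}$. Order on $\mathbb{I}$: $A\leq^{\min}B$ iff either $a^c<b^c$, or $a^c=b^c$ and $a^w\le b^w$ (a total order). A map $Q$ from a subset of $\mathbb{R}$ to $\mathbb{I}$ is non-decreasing if $s<t$ implies $Q(s)\leq^{\min}Q(t)$. An interval-valued function (IVF) on $E\subseteq M$ is a map $f:E\to\mathbb{I}$, written $f(x)=\langle f^c(x),f^w(x)\rangle$, with $f^c,f^w:E\to\mathbb{R}$ and $f^w\ge 0$. $E\subseteq M$ is star-shaped at $x_0\in E$ if for every $x\in E$ and every geodesic $\gamma_{x_0x}:[0,1]\to M$ with $\gamma_{x_0x}(0)=x_0$, $\gamma_{x_0x}(1)=x$, one has $\gamma_{x_0x}(s)\in E$ for all $s\in(0,1)$. For such $E$, a function $h:E\to\mathbb{R}$ is convex at $x_0$ if $h(\gamma_{x_0x}(s))\le(1-s)h(x_0)+s\,h(x)$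 for all $x\in E$, all geodesics $\gamma_{x_0x}$ emanating from $x_0$ and terminating at $x$ and all $s\in(0,1)$. An IVF $f$ is cw-convex at $x_0$ if $f^c$ and $f^w$ are both convex at $x_0$. $T_x(E)$ denotes the set of tangent vectors to $E$ at $x$; directional derivatives are taken in directions $X_x\in T_x(E)$ for which there is a geodesic $\gamma$ defined on an interval $I\ni 0$ containing some $s>0$, with $\gamma(I)\subseteq E$, $\gamma(0)=x$, $\dot\gamma(0)=X_x$. For such a $\gamma$, the directional derivative of a real-valued $h:E\to\mathbb{R}$ is $Dh(x;X_x)=\lim_{s\to0^+}\frac{h(\gamma(s))-h(x)}{s}$, when this (finite) limit exists, and the gH-directional derivative of an IVF $f$ is $Df(x;X_x)=\lim_{s\to0^+}\frac1s\big(f(\gamma(s))\ominus_{gH}f(x)\big)\in\mathbb{I}$, when this limit exists. *)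

(* Defs.v *)
From mathcomp Require Import all_boot all_order all_algebra.
From mathcomp Require Import all_classical all_reals all_analysis.
From mathcomp Require Import ring lra.

Set Implicit Arguments.
Unset Strict Implicit.
Unset Printing Implicit Defensive.

Import Order.TTheory GRing.Theory Num.Theory numFieldNormedType.Exports.

Local Open Scope classical_set_scope.
Local Open Scope ring_scope.

Section Smooth.
Context {R : realType} {n : nat}.
Implicit Types (U : set 'rV[R]_n) (F : 'rV[R]_n -> R).

(* Partial derivatives are derivatives of one-variable slices, so that no norm
   on ['rV_n] is needed and [n = 0] is allowed. *)
Definition slice F (x : 'rV[R]_n) (i : 'I_n) : R -> R :=
  fun t => F (x + t *: delta_mx 0 i).

Definition partial (i : 'I_n) F : 'rV[R]_n -> R :=
  fun x => derive1 (slice F x i) 0.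

Fixpoint Ck_on (k : nat) U F : Prop :=
  (forall x, U x -> {for x, continuous F}) /\
  match k with
  | 0 => True
  | k'.+1 => forall i : 'I_n,
      (forall x, U x -> derivable (slice F x i) 0 1) /\ Ck_on k' U (partial i F)
  end.

Definition smooth_on U F : Prop := forall k, Ck_on k U F.

Definition smooth_map_on U (T : 'rV[R]_n -> 'rV[R]_n) : Prop :=
  forall j, smooth_on U (fun x => T x 0 j).

(* Vectors are rows: the differential of [T] at [x] is [v |-> v *m jacmx T x]. *)
Definition jacmx (T : 'rV[R]_n -> 'rV[R]_n) (x : 'rV[R]_n) : 'M[R]_n :=
  \matrix_(i, j) partial i (fun y => T y 0 j) x.

End Smooth.

Record chart (R : realType) (T : topologicalType) (n : nat) := Chart {
  cdom : set T;
  cimg : set 'rV[R]_n;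
  cmap : T -> 'rV[R]_n;
  cinv : 'rV[R]_n -> T;
  cdom_open : open cdom;
  cimg_open : open cimg;
  cmap_img : forall p, cdom p -> cimg (cmap p);
  cinv_dom : forall x, cimg x -> cdom (cinv x);
  cmapK : forall p, cdom p -> cinv (cmap p) = p;
  cinvK : forall x, cimg x -> cmap (cinv x) = x;
  cmap_continuous : forall p, cdom p -> {for p, continuous cmap};
  cinv_continuous : forall x, cimg x -> {for x, continuous cinv} }.

Definition transition {R : realType} {T : topologicalType} {n : nat}
    (a b : chart R T n) : 'rV[R]_n -> 'rV[R]_n :=
  cmap b \o cinv a.

Definition transition_dom {R : realType} {T : topologicalType} {n : nat}
    (a b : chart R T n) : set 'rV[R]_n :=
  [set x | cimg a x /\ cdom b (cinv a x)].

(* [gmx a x] is the matrix of the metric tensor in the coordinates of the chart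
   [atlas a], at the point of coordinates [x]. *)
Record riemannian (R : realType) (n : nat) := Riemannian {
  carrier :> topologicalType;
  carrier_hausdorff : hausdorff_space carrier;
  carrier_second_countable : @second_countable carrier;
  aidx : Type;
  atlas : aidx -> chart R carrier n;
  atlas_cover : forall p, exists a, cdom (atlas a) p;
  atlas_smooth : forall a b,
    smooth_map_on (transition_dom (atlas a) (atlas b))
                  (transition (atlas a) (atlas b));
  gmx : aidx -> 'rV[R]_n -> 'M[R]_n;
  gmx_smooth : forall a i j, smooth_on (cimg (atlas a)) (fun x => gmx a x i j);
  gmx_sym : forall a x, cimg (atlas a) x -> (gmx a x)^T = gmx a x;
  gmx_posdef : forall a x (v : 'rV[R]_n), cimg (atlas a) x -> v != 0 ->
    0 < (v *m gmx a x *m v^T) 0 0;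
  gmx_compat : forall a b x, transition_dom (atlas a) (atlas b) x ->
    let T := transition (atlas a) (atlas b) in
    gmx a x = jacmx T x *m gmx b (T x) *m (jacmx T x)^T }.

Arguments aidx {R n} M : rename.
Arguments atlas {R n M} a : rename.
Arguments gmx {R n M} a x : rename.

Section Geometry.
Context {R : realType} {n : nat} {M : riemannian R n}.

(* A tangent vector at [p] is the family of its coordinates in the charts around
   [p]; the components at the other charts are set to 0, so that equality of
   records (up to proofs) is equality of tangent vectors. *)
Record tvec (p : M) := TVec {
  tcoord : aidx M -> 'rV[R]_n;
  tcoord_compat : forall a b, cdom (atlas a) p -> cdom (atlas b) p ->
    tcoord b =
    tcoord a *m jacmx (transition (atlas a) (atlas b)) (cmap (atlas a) p);
  tcoord_out : forall a, ~ cdom (atlas a) p -> tcoord a = 0 }.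

Section TScale.
Variables (p : M) (k : R) (X : tvec p).

Lemma tscale_compat a b : cdom (atlas a) p -> cdom (atlas b) p ->
  k *: tcoord X b =
  (k *: tcoord X a)
    *m jacmx (transition (atlas a) (atlas b)) (cmap (atlas a) p).
Proof. by move=> pa pb; rewrite -scalemxAl -tcoord_compat. Qed.

Lemma tscale_out a : ~ cdom (atlas a) p -> k *: tcoord X a = 0.
Proof. by move=> pa; rewrite tcoord_out // scaler0. Qed.

Definition tscale : tvec p :=
  @TVec p (fun a => k *: tcoord X a) tscale_compat tscale_out.
End TScale.

(* Christoffel symbols of the Riemannian (Levi-Civita) connection in the
   coordinates of the chart [atlas a]. *)
Definition christoffel (a : aidx M) (x : 'rV[R]_n) (k i j : 'I_n) : R :=
  2^-1 * \sum_(l < n) invmx (gmx a x) k l *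
    (partial i (fun y => gmx a y j l) x + partial j (fun y => gmx a y i l) x
     - partial l (fun y => gmx a y i j) x).

(* Derivative relative to [I]: one-sided at the end points of an interval. *)
Definition has_deriv_within (I : set R) (c : R -> 'rV[R]_n) (t : R)
    (v : 'rV[R]_n) : Prop :=
  (fun s => (s - t)^-1 *: (c s - c t)) @ within I t^' --> v.

(* [I] is meant to be an interval; the values of [g] outside [I] are irrelevant.
   [V a] is the velocity of [g] in the coordinates of the chart [atlas a]. *)
Definition geodesic_on (I : set R) (g : R -> M) : Prop :=
  {within I, continuous g} /\
  exists V : aidx M -> R -> 'rV[R]_n,
    forall a t, I t -> cdom (atlas a) (g t) ->
      has_deriv_within I (cmap (atlas a) \o g) t (V a t) /\
      has_deriv_within I (V a) t
        (\row_k - \sum_(i < n) \sum_(j < n)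
           christoffel a (cmap (atlas a) (g t)) k i j * V a t 0 i * V a t 0 j).

(* [g 0 = p] and [g'(0) = X] *)
Definition starts_at (I : set R) (g : R -> M) (p : M) (X : tvec p) : Prop :=
  g 0 = p /\
  forall a, cdom (atlas a) p ->
    has_deriv_within I (cmap (atlas a) \o g) 0 (tcoord X a).

(* Equivalent to metric completeness by the Hopf-Rinow theorem when [M] is
   connected. *)
Definition geodesically_complete : Prop :=
  forall (p : M) (X : tvec p),
    exists g : R -> M, geodesic_on setT g /\ starts_at setT g X.

Definition geodesic_from_to (x0 x : M) (g : R -> M) : Prop :=
  [/\ geodesic_on `[0, 1] g, g 0 = x0 & g 1 = x].

Definition star_shaped_at (E : set M) (x0 : M) : Prop :=
  E x0 /\
  forall (x : M) (g : R -> M), E x -> geodesic_from_to x0 x g ->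
    forall s : R, 0 < s < 1 -> E (g s).

Definition convex_at (E : set M) (x0 : M) (h : M -> R) : Prop :=
  forall (x : M) (g : R -> M), E x -> geodesic_from_to x0 x g ->
    forall s : R, 0 < s < 1 -> h (g s) <= (1 - s) * h x0 + s * h x.

(* The curves along which directional derivatives at [x] in the direction [X]
   are computed. *)
Definition dir_geodesic (E : set M) (x : M) (X : tvec x) (I : set R)
    (g : R -> M) : Prop :=
  [/\ is_interval I, I 0, (exists2 s, I s & 0 < s),
      geodesic_on I g /\ starts_at I g X & forall s, I s -> E (g s)].

(* [T_x(E)], taken to be the set of directions in which directional derivatives
   are defined. *)
Definition tangent_set (E : set M) (x : M) : set (tvec x) :=
  [set X | exists I g, dir_geodesic E X I g].

End Geometry.

Arguments geodesically_complete {R n} M.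

Definition itvl (R : realType) := {p : R * R | p.1 <= p.2}.

Section Intervals.
Context {R : realType}.
Implicit Types (A B : itvl R) (k : R).

Definition lo A : R := (val A).1.
Definition hi A : R := (val A).2.
Definition center A : R := (lo A + hi A) / 2.
Definition hwidth A : R := (hi A - lo A) / 2.

Definition mkitvl (a b : R) (ab : a <= b) : itvl R := exist _ (a, b) ab.

Lemma cw_subproof (c w : R) : 0 <= w -> c - w <= c + w.
Proof. lra. Qed.

Definition cw (c w : R) (w0 : 0 <= w) : itvl R := mkitvl (cw_subproof c w0).

Lemma iscale_subproof k A :
  (if 0 <= k then k * lo A else k * hi A)
  <= (if 0 <= k then k * hi A else k * lo A).
Proof.
have AP : lo A <= hi A := valP A.
by case: (leP 0 k) => k0; [rewrite ler_wpM2l | rewrite ler_wnM2l // ltW].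
Qed.

Definition iscale k A : itvl R := mkitvl (iscale_subproof k A).

Lemma gHsub_subproof A B :
  Num.min (lo A - lo B) (hi A - hi B) <= Num.max (lo A - lo B) (hi A - hi B).
Proof. by rewrite ge_min le_max lexx. Qed.

Definition gHsub A B : itvl R := mkitvl (gHsub_subproof A B).

Definition dH A B : R := Num.max `|lo A - lo B| `|hi A - hi B|.

Definition le_min A B : Prop :=
  center A < center B \/ (center A = center B /\ hwidth A <= hwidth B).

Definition cvg_itvl (F : set_system R) (Q : R -> itvl R) (A : itvl R) : Prop :=
  (fun s => dH (Q s) A) @ F --> (0 : R).

Definition nondecreasing_itvl_on (D : set R) (Q : R -> itvl R) : Prop :=
  forall s t, D s -> D t -> s < t -> le_min (Q s) (Q t).

End Intervals.

(* Functions on a subset [E] of [M] are total functions on [M], of which only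
   the values on [E] are used. *)

Section Derivatives.
Context {R : realType} {n : nat} {M : riemannian R n}.
Variable E : set M.

Definition has_dd (h : M -> R) (x : M) (X : tvec x) (d : R) : Prop :=
  exists I g, dir_geodesic E X I g /\
    (fun s => (h (g s) - h x) / s) @ within I 0^'+ --> d.

Definition dd_exists (h : M -> R) (x : M) (X : tvec x) : Prop :=
  exists d, has_dd h X d.

Definition dd (h : M -> R) (x : M) (X : tvec x) : R := xget 0 (has_dd h X).

Definition gHquot (f : M -> itvl R) (x : M) (g : R -> M) (s : R) : itvl R :=
  iscale s^-1 (gHsub (f (g s)) (f x)).

Definition has_gHdd (f : M -> itvl R) (x : M) (X : tvec x) (D : itvl R) : Prop :=
  exists I g, dir_geodesic E X I g /\ cvg_itvl (within I 0^'+) (gHquot f x g) D.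

Definition gHdd_exists (f : M -> itvl R) (x : M) (X : tvec x) : Prop :=
  exists D, has_gHdd f X D.

Definition gHdd (f : M -> itvl R) (x : M) (X : tvec x) : itvl R :=
  xget (mkitvl (lexx 0)) (has_gHdd f X).

Definition fc (f : M -> itvl R) : M -> R := fun x => center (f x).
Definition fw (f : M -> itvl R) : M -> R := fun x => hwidth (f x).

Definition cw_convex_at (x0 : M) (f : M -> itvl R) : Prop :=
  convex_at E x0 (fc f) /\ convex_at E x0 (fw f).

End Derivatives.

(* Main.v *)
Require Import Defs.
From mathcomp Require Import all_boot all_order all_algebra.
From mathcomp Require Import all_classical all_reals all_analysis.
From mathcomp Require Import ring lra.

Set Implicit Arguments.
Unset Strict Implicit.
Unset Printing Implicit Defensive.

Import Order.TTheory GRing.Theory Num.Theory numFieldNormedType.Exports.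

Local Open Scope classical_set_scope.
Local Open Scope ring_scope.

(** For [s < t] in [I], the curve [u |-> g (t * u)] is a geodesic from [x0] to
    [g t] that passes through [g s] at [u = s / t].  Convexity at [x0] therefore
    makes the difference quotients of [fc f] and of [fw f] along [g]
    nondecreasing ([convex_at_slope_mono]).  In centre and half-width
    coordinates, the gH-quotient has as centre the quotient of [fc f], and as
    half-width the absolute value of the quotient of [fw f]; since [fw f] grows
    along [g], the absolute value disappears.  This gives (i).  The distance
    [dH] is the sum of the distances between centres and between half-widths
    ([dHE]), so that an interval limit is exactly a pair of limits
    ([cvg_itvlP]), which gives the formula in (ii)(a).  Positive homogeneity
    holds because the gH-quotient at [s] along [u |-> y (k * u)] is [k] times
    the one at [k * s] along [y], for [k > 0]; for [k = 0] the geodesic is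
    constant.

    The derivative [gHdd E f X] is the limit along some geodesic with initial
    velocity [X], possibly not the given one.  It is well defined because two
    geodesics with the same initial velocity agree for small positive times
    ([geodesic_unique_germ]).  In a chart the geodesic equation is a first order
    system for (position, velocity).  Let [D t] be the Euclidean distance between the
    states of the two solutions at time [t].  Call two functions of time close
    when they have the same limit at [0] and differ by at most a constant times
    [D] ([lipclose]).  Closeness is preserved by sums, products, inverses
    (at nonzero limits), determinants and matrix inverses, and by C^1 functions of the position;
    hence the two right-hand sides of the system are close, and a Gronwall
    argument ([gronwall_zero]) forces [D = 0].  Working with close pairs along
    the two solutions replaces a theory of locally Lipschitz functions of
    several variables. *)

(** * Pairs of functions that differ by O(D) *)

Section LipClose.
Context {R : realType} {T : Type} {F : set_system T} {FF : Filter F}.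
Variable D : T -> R.
Hypothesis D_ge0 : forall t, 0 <= D t.

Lemma cvgr_bounded (f : T -> R) (l : R) :
  f @ F --> l -> \forall t \near F, `|f t| <= `|l| + 1.
Proof. by move=> fl; apply: (cvgr_norm_le _ fl); rewrite ltrDl. Qed.

(** The common limit [l] is recorded because it provides the local bounds on
    which stability under products and inverses rests. *)
Definition lipclose (l : R) (phi psi : T -> R) : Prop :=
  [/\ phi @ F --> l, psi @ F --> l &
      exists2 K, 0 <= K & \forall t \near F, `|phi t - psi t| <= K * D t].

Lemma lipclose_cst l : lipclose l (cst l) (cst l).
Proof.
split; [exact: cvg_cst | exact: cvg_cst | exists 0 => //].
by apply: nearW => t; rewrite subrr normr0 mul0r.
Qed.

Lemma lipcloseD l l' phi psi phi' psi' :
  lipclose l phi psi -> lipclose l' phi' psi' ->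
  lipclose (l + l') (fun t => phi t + phi' t) (fun t => psi t + psi' t).
Proof.
move=> [c1 c2 [K K0 HK]] [c1' c2' [K' K'0 HK']].
split; [exact: cvgD | exact: cvgD | exists (K + K'); first exact: addr_ge0].
apply: filterS2 HK HK' => t h h'.
rewrite opprD addrACA (le_trans (ler_normD _ _))// mulrDl lerD//.
Qed.

Lemma lipcloseM l l' phi psi phi' psi' :
  lipclose l phi psi -> lipclose l' phi' psi' ->
  lipclose (l * l') (fun t => phi t * phi' t) (fun t => psi t * psi' t).
Proof.
move=> [c1 c2 [K K0 HK]] [c1' c2' [K' K'0 HK']].
split; [exact: cvgM | exact: cvgM |].
exists ((`|l| + 1) * K' + K * (`|l'| + 1)).
  by rewrite addr_ge0// mulr_ge0// addr_ge0.
have b1 : \forall t \near F, `|phi t| <= `|l| + 1.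
  exact: cvgr_bounded c1.
have b2 : \forall t \near F, `|psi' t| <= `|l'| + 1.
  exact: cvgr_bounded c2'.
apply: filterS2 (filterI b1 b2) (filterI HK HK') => t [p1 p2] [h h'].
have -> : phi t * phi' t - psi t * psi' t
  = phi t * (phi' t - psi' t) + (phi t - psi t) * psi' t by ring.
rewrite (le_trans (ler_normD _ _))// !normrM mulrDl lerD//.
  by rewrite -mulrA ler_pM.
by rewrite mulrAC ler_pM.
Qed.

Lemma lipcloseN l phi psi : lipclose l phi psi ->
  lipclose (- l) (fun t => - phi t) (fun t => - psi t).
Proof.
move=> [c1 c2 [K K0 HK]]; split; [exact: cvgN | exact: cvgN | exists K => //].
by apply: filterS HK => t; rewrite -opprD normrN.
Qed.

Lemma lipcloseB l l' phi psi phi' psi' :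
  lipclose l phi psi -> lipclose l' phi' psi' ->
  lipclose (l - l') (fun t => phi t - phi' t) (fun t => psi t - psi' t).
Proof. by move=> H /lipcloseN; exact: lipcloseD. Qed.

Lemma lipcloseV l phi psi : l != 0 -> lipclose l phi psi ->
  lipclose l^-1 (fun t => (phi t)^-1) (fun t => (psi t)^-1).
Proof.
move=> l0 [c1 c2 [K K0 HK]].
have v1 : (fun t => (phi t)^-1) @ F --> l^-1 by exact: cvgV l0 c1.
have v2 : (fun t => (psi t)^-1) @ F --> l^-1 by exact: cvgV l0 c2.
split=> //.
have b0 : 0 <= `|l^-1| + 1 by rewrite addr_ge0.
have b1 : \forall t \near F, `|(phi t)^-1| <= `|l^-1| + 1.
  exact: cvgr_bounded v1.
have b2 : \forall t \near F, `|(psi t)^-1| <= `|l^-1| + 1.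
  exact: cvgr_bounded v2.
exists ((`|l^-1| + 1) * (`|l^-1| + 1) * K); first by rewrite !mulr_ge0.
have n1 : \forall t \near F, phi t != 0.
  by apply: cvgr_neq0 c1 _.
have n2 : \forall t \near F, psi t != 0.
  by apply: cvgr_neq0 c2 _.
apply: filterS3 (filterI b1 b2) (filterI n1 n2) HK => t [p1 p2] [q1 q2] h.
have -> : (phi t)^-1 - (psi t)^-1
   = (phi t)^-1 * (psi t)^-1 * (psi t - phi t) by field; apply/andP.
by rewrite !normrM distrC -mulrA -(mulrA _ K) mulrA ler_pM ?mulr_ge0// ler_pM.
Qed.

Lemma lipclose_near l phi psi phi' psi' :
  (\forall t \near F, phi t = phi' t) -> (\forall t \near F, psi t = psi' t) ->
  lipclose l phi psi -> lipclose l phi' psi'.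
Proof.
move=> e1 e2 [c1 c2 [K K0 HK]]; split.
- by apply: cvg_trans c1; apply: near_eq_cvg; apply: filterS e1.
- by apply: cvg_trans c2; apply: near_eq_cvg; apply: filterS e2.
- by exists K => //; apply: filterS3 e1 e2 HK => t <- <-.
Qed.

Lemma eq_lipclose l l' phi psi phi' psi' : l' = l ->
  phi' =1 phi -> psi' =1 psi -> lipclose l phi psi -> lipclose l' phi' psi'.
Proof. by move=> -> /funext -> /funext ->. Qed.

Lemma lipclose_sum (J : Type) (r : seq J) (P : pred J)
    (l : J -> R) (phi psi : J -> T -> R) :
  (forall j, P j -> lipclose (l j) (phi j) (psi j)) ->
  lipclose (\sum_(j <- r | P j) l j) (fun t => \sum_(j <- r | P j) phi j t)
    (fun t => \sum_(j <- r | P j) psi j t).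
Proof.
move=> H; elim: r => [|j r IH].
  by apply: eq_lipclose (lipclose_cst 0) => [|t|t]; rewrite big_nil.
have [Pj|nPj] := boolP (P j); last first.
  by apply: eq_lipclose IH => [|t|t]; rewrite big_cons (negbTE nPj).
by apply: eq_lipclose (lipcloseD (H _ Pj) IH) => [|t|t]; rewrite big_cons Pj.
Qed.

Lemma lipclose_prod (J : Type) (r : seq J) (P : pred J)
    (l : J -> R) (phi psi : J -> T -> R) :
  (forall j, P j -> lipclose (l j) (phi j) (psi j)) ->
  lipclose (\prod_(j <- r | P j) l j) (fun t => \prod_(j <- r | P j) phi j t)
    (fun t => \prod_(j <- r | P j) psi j t).
Proof.
move=> H; elim: r => [|j r IH].
  by apply: eq_lipclose (lipclose_cst 1) => [|t|t]; rewrite big_nil.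
have [Pj|nPj] := boolP (P j); last first.
  by apply: eq_lipclose IH => [|t|t]; rewrite big_cons (negbTE nPj).
by apply: eq_lipclose (lipcloseM (H _ Pj) IH) => [|t|t]; rewrite big_cons Pj.
Qed.

Lemma lipclose_det m (A : 'M[R]_m) (B C : T -> 'M[R]_m) :
  (forall i j, lipclose (A i j) (fun t => B t i j) (fun t => C t i j)) ->
  lipclose (\det A) (fun t => \det (B t)) (fun t => \det (C t)).
Proof.
move=> H; rewrite /determinant; apply: lipclose_sum => s _.
apply: lipcloseM; first exact: lipclose_cst.
by apply: lipclose_prod => i _; exact: H.
Qed.

(** Cramer's rule reduces inverse matrices to determinants.  As [invmx] is given
    by this rule only at invertible matrices, it is used where the determinants
    of [B t] and [C t], which tend to that of [A], are nonzero. *)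
Lemma lipclose_invmx m (A : 'M[R]_m) (B C : T -> 'M[R]_m) :
  A \in unitmx ->
  (forall i j, lipclose (A i j) (fun t => B t i j) (fun t => C t i j)) ->
  forall i j, lipclose (invmx A i j) (fun t => invmx (B t) i j)
    (fun t => invmx (C t) i j).
Proof.
move=> uA H i j.
have dA : \det A != 0 by rewrite -unitfE -unitmxE.
have [dB dC _] := lipclose_det H.
have invE (X : 'M[R]_m) : \det X != 0 ->
    (\det X)^-1 * cofactor X j i = invmx X i j.
  by move=> dX; rewrite /invmx unitmxE unitfE dX !mxE.
rewrite -(invE _ dA).
apply: (@lipclose_near _ (fun t => (\det (B t))^-1 * cofactor (B t) j i)
  (fun t => (\det (C t))^-1 * cofactor (C t) j i)).
- by apply: filterS (cvgr_neq0 _ dB dA) => t; exact: invE.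
- by apply: filterS (cvgr_neq0 _ dC dA) => t; exact: invE.
apply: lipcloseM; first by apply: lipcloseV => //; exact: lipclose_det.
apply: lipcloseM; first exact: lipclose_cst.
apply: lipclose_det => k l.
by apply: eq_lipclose (H (lift j k) (lift i l)) => [|t|t]; rewrite !mxE.
Qed.

End LipClose.

(** * Functions of class C^1 are locally Lipschitz *)

Lemma MVT_lipschitz {R : realType} (f df : R -> R) (a b L : R) :
  (forall s, Num.min a b <= s <= Num.max a b ->
     is_derive s 1 f (df s) /\ `|df s| <= L) ->
  `|f b - f a| <= L * `|b - a|.
Proof.
wlog ab : a b / a <= b.
  move=> H H'; have [/H|/ltW/H] := leP a b; first exact.
  rewrite distrC (distrC a); apply=> s; rewrite minC maxC; exact: H'.
rewrite min_l// max_r// => H.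
have [c cab ->] : exists2 c, c \in `[a, b] & f b - f a = df c * (b - a).
  apply: MVT_segment => // [s|].
    by rewrite in_itv/= => /andP[? ?]; apply: (H s _).1; rewrite !ltW.
  apply: derivable_within_continuous => s; rewrite in_itv/= => sab.
  by have [[]] := H _ sab.
rewrite normrM ler_wpM2r//; apply: (H _ _).2.
by rewrite in_itv in cab.
Qed.

Lemma is_derive_translate {R : realType} (f : R -> R) (s d : R) :
  is_derive (0 : R) 1 (fun t => f (t + s)) d -> is_derive s 1 f d.
Proof.
have E : (fun h : R => h^-1 *: (((fun t => f (t + s)) \o shift 0) (h *: (1 : R))
            - (fun t => f (t + s)) 0))
       = (fun h : R => h^-1 *: ((f \o shift s) (h *: (1 : R)) - f s)).
  by apply/funext => h /=; rewrite addr0 add0r.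
move=> [d1 d2]; split; first by rewrite /derivable -E.
by rewrite -d2 /derive -E.
Qed.

Section C1.
Context {R : realType} {n : nat}.
Implicit Types (U : set 'rV[R]_n) (F : 'rV[R]_n -> R).

(** [partial] only looks at slices at parameter [0]; translating the base point
    gives the derivative of a slice at every parameter. *)
Lemma slice_is_derive U F i (w : 'rV[R]_n) (s : R) :
  Ck_on 1 U F -> U (w + s *: delta_mx 0 i) ->
  is_derive s 1 (slice F w i) (partial i F (w + s *: delta_mx 0 i)).
Proof.
move=> [_ H] Uw; apply: is_derive_translate.
have -> : (fun t => slice F w i (t + s)) = slice F (w + s *: delta_mx 0 i) i.
  by apply/funext => t; rewrite /slice scalerDl (addrC (t *: _)) addrA.
have [/(_ _ Uw) d _] := H i.
split=> //; by rewrite /partial derive1E.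
Qed.

(** One goes from [y] to [z] by changing one coordinate at a time, inside a ball
    (which is a box) where the partial derivatives are bounded; the mean value
    theorem bounds each of these steps. *)
Lemma C1_lipschitz U F x : open U -> U x -> Ck_on 1 U F ->
  exists r L, [/\ 0 < r, 0 <= L & forall y z, ball x r y -> ball x r z ->
    `|F y - F z| <= L * \sum_i `|y 0 i - z 0 i| ].
Proof.
move=> oU Ux F1.
pose L := \sum_i (`|partial i F x| + 1).
have L0 : 0 <= L by apply: sumr_ge0 => i _; rewrite addr_ge0.
have [r r0 Hr] : exists2 r : R, 0 < r & forall w, ball x r w ->
    U w /\ forall i, `|partial i F w| <= L.
  have nU : \forall w \near x, U w by apply: open_nbhs_nbhs.
  have nL : \forall w \near x, forall i, `|partial i F w| <= L.
    apply: (@filter_forall _ _ (fun i w => `|partial i F w| <= L) _ (nbhs_filter x)) => i.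
    have ci : partial i F @ x --> partial i F x.
      by have [_ [+ _]] := F1.2 i; exact.
    apply: filterS (cvgr_bounded ci) => w /le_trans; apply.
    rewrite /L (bigD1 i)//= lerDl; apply: sumr_ge0 => j _.
    by rewrite addr_ge0.
  have [r r0 H] := (nbhs_ballP _ _).1 (filterI nU nL).
  by exists r => // w /H.
exists r, L; split=> // y z xy xz.
(* the first [k] coordinates are those of [z], the others those of [y] *)
pose w (k : nat) : 'rV[R]_n := \row_j (if (j < k)%N then z 0 j else y 0 j).
have w0 : w 0%N = y by apply/rowP => j; rewrite mxE ltn0.
have wn : w n = z by apply/rowP => j; rewrite mxE ltn_ord.
have -> : F y - F z = - \sum_(0 <= k < n) (F (w k.+1) - F (w k)).
  by rewrite telescope_sumr// w0 wn opprB.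
rewrite normrN big_mkord (le_trans (ler_norm_sum _ _ _))// mulr_sumr.
apply: ler_sum => k _.
have wS : w k.+1 = w k + (z 0 k - y 0 k) *: delta_mx 0 k.
  apply/rowP => j; rewrite !mxE /= ltnS leq_eqVlt.
  have [->|jk] := eqVneq j k; first by rewrite eqxx ltnn /= mulr1; ring.
  by rewrite (negbTE (jk : (j != k :> nat)%N)) mulr0 addr0.
have slice0 : slice F (w k) k 0 = F (w k) by rewrite /slice scale0r addr0.
rewrite wS -slice0.
rewrite (distrC (y 0 k)) -[in leRHS](subr0 (z 0 k - _)).
apply: (@MVT_lipschitz _ (slice F (w k) k)
  (fun s => partial k F (w k + s *: delta_mx 0 k))) => s hs.
have /Hr[Uw Lw] : ball x r (w k + s *: delta_mx 0 k).
  split=> // i j; rewrite !mxE ord1 /=.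
  move: (xy.2 0 j) (xz.2 0 j); rewrite /ball /=.
  have [->|jk] := eqVneq j k; last first.
    by rewrite /= mulr0 addr0; case: ifP.
  rewrite ltnn /= mulr1; move: hs.
  rewrite !ltr_distl ge_min le_max; case: (leP 0 (z 0 k - y 0 k)) => ?; lra.
by split; [exact: slice_is_derive F1 Uw | exact: Lw].
Qed.

Lemma lipclose_C1 {T : Type} {G : set_system T} {FG : Filter G} (D : T -> R)
    U F x (c1 c2 : T -> 'rV[R]_n) :
  open U -> U x -> Ck_on 1 U F -> c1 @ G --> x -> c2 @ G --> x ->
  (\forall t \near G, forall i, `|c1 t 0 i - c2 t 0 i| <= D t) ->
  lipclose (F := G) D (F x) (F \o c1) (F \o c2).
Proof.
move=> oU Ux F1 h1 h2 hD.
have cF : F @ x --> F x by exact: F1.1.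
split; [exact: cvg_comp h1 cF | exact: cvg_comp h2 cF |].
have [r [L [r0 L0 H]]] := C1_lipschitz oU Ux F1.
exists (L * n%:R); first by rewrite mulr_ge0.
have b1 : \forall t \near G, ball x r (c1 t) := h1 _ (nbhsx_ballx x r r0).
have b2 : \forall t \near G, ball x r (c2 t) := h2 _ (nbhsx_ballx x r r0).
apply: filterS3 b1 b2 hD => t y1 y2 hi.
apply: le_trans (H _ _ y1 y2) _.
rewrite -mulrA ler_wpM2l// mulr_natl -[n in _ *+ n]card_ord -sumr_const.
by apply: ler_sum => i _.
Qed.

End C1.

(** * A Gronwall lemma at 0+ *)

Lemma near_at_right0 {R : realType} (P : R -> Prop) :
  (\forall t \near (0 : R)^'+, P t) -> exists2 e : R, 0 < e & forall t, 0 < t < e -> P t.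
Proof.
move=> /nbhs_ballP[e e0 H]; exists e => // t /andP[t0 te].
by apply: H => //; rewrite /ball/= sub0r normrN gtr0_norm.
Qed.

Lemma is_derive_sum_fun {R : realType} (J : Type) (r : seq J)
    (f : J -> R -> R) (d : J -> R) (t : R) :
  (forall j, is_derive t 1 (f j) (d j)) ->
  is_derive t 1 (fun s => \sum_(j <- r) f j s) (\sum_(j <- r) d j).
Proof.
move=> H; elim: r => [|j r IH].
  rewrite big_nil (_ : (fun _ => _) = cst 0); first exact: is_derive_cst.
  by apply/funext => s; rewrite big_nil.
rewrite big_cons.
rewrite (_ : (fun _ => _) = f j \+ (fun t => \sum_(j <- r) f j t)).
  exact: is_deriveD (H j) IH.
by apply/funext => s; rewrite big_cons.
Qed.

(** The squared norm [S] satisfies [S' <= C * S] with [C = 2 * K * #|J|], so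
    [exp (- C * t) * S t] is nonincreasing on some interval [(0, e)]; as it is
    nonnegative and tends to [0] at the left end point, it vanishes. *)
Lemma gronwall_zero {R : realType} {J : finType} (y dy : J -> R -> R) (K : R) :
  (forall j, y j @ (0 : R)^'+ --> (0 : R)) ->
  (\forall t \near (0 : R)^'+, forall j,
     is_derive t (1 : R) (y j) (dy j t) /\
     `|dy j t| <= K * Num.sqrt (\sum_i y i t ^+ 2)) ->
  \forall t \near (0 : R)^'+, forall j, y j t = 0.
Proof.
move=> y0 /near_at_right0[e e0 H].
pose S t := \sum_i y i t ^+ 2.
pose C := K * #|J|%:R *+ 2.
pose psi t := expR (- (C * t)) * S t.
have S_ge0 t : 0 <= S t by apply: sumr_ge0 => i _; exact: sqr_ge0.
have yS j t : `|y j t| <= Num.sqrt (S t).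
  rewrite -sqrtr_sqr ler_wsqrtr// /S (bigD1 j)//= lerDl.
  by apply: sumr_ge0 => i _; exact: sqr_ge0.
have dpsi t : 0 < t < e -> is_derive t 1 psi
   (expR (- (C * t)) * (\sum_j (y j t * dy j t) *+ 2 - C * S t)).
  move=> /H Ht.
  have dS : is_derive t 1 S (\sum_j (y j t * dy j t) *+ 2).
    apply: is_derive_sum_fun => j.
    have := is_deriveX 2 (Ht j).1.
    by rewrite /= expr1 /GRing.scale/= -mulrA mulr_natl.
  have dE : is_derive t (1 : R) (fun t => expR (- (C * t))) (expR (- (C * t)) * - C).
    apply: (@is_derive1_comp _ expR (fun t => - (C * t))).
    apply: is_deriveN.
    have := @is_deriveZ _ _ _ id C t 1 1 (is_derive_id _ _).
    by rewrite /GRing.scale/= mulr1.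
  have := is_deriveM dE dS; rewrite /GRing.scale/=.
  by congr is_derive; ring.
have dpsi_le0 t : 0 < t < e ->
    expR (- (C * t)) * (\sum_j (y j t * dy j t) *+ 2 - C * S t) <= 0.
  move=> /H Ht; rewrite pmulr_rle0 ?expR_gt0// subr_le0.
  have -> : C * S t = \sum_(j : J) (K * S t) *+ 2.
    by rewrite sumr_const /C -mulrnA mulnC mulrnA !mulrnAl mulr_natr mulrnAl.
  apply: ler_sum => j _; rewrite lerMn2r/=.
  apply: le_trans (ler_norm _) _; rewrite normrM.
  rewrite -(sqr_sqrtr (S_ge0 t)) expr2 mulrCA ler_pM//.
  exact: (Ht j).2.
have psi0 : psi @ (0 : R)^'+ --> (0 : R).
  rewrite [X in _ --> X](_ : 0 = expR (- (C * 0)) * \sum_(i : J) 0 ^+ 2); last first.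
    by rewrite big1 ?mulr0// => i _; rewrite expr0n.
  apply: cvgM; last first.
    apply: (cvg_big add_continuous) => j _.
    by apply: (cvg_comp _ (fun x : R => x ^+ 2) (y0 j)); exact: exprn_continuous.
  apply: (cvg_comp (fun t => - (C * t)) expR); last exact: continuous_expR.
  apply: cvgN; apply: cvgM; first exact: cvg_cst.
  by apply: cvg_at_right_filter; exact: cvg_id.
have inI u : u \in `]0, e[ -> 0 < u < e by rewrite in_itv.
have psi_mono : {in `]0, e[ &, {homo psi : u v /~ u <= v}}.
  apply: ler0_derive1_le_oo.
  - by move=> u /inI /dpsi [].
  - move=> u /inI ue; rewrite derive1E.
    by rewrite (@derive_val _ _ _ _ _ _ _ (dpsi _ ue)) dpsi_le0.
  - move=> u; rewrite inE/= => /inI /dpsi[du _].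
    exact/differentiable_continuous/derivable1_diffP.
have psi_le0 t : 0 < t < e -> psi t <= 0.
  move=> /andP[t0 te]; apply: (cvgr_to_ge psi0).
  near=> s.
  have /andP[s0 st] : 0 < s < t.
    by apply/andP; split; near: s; [exact: nbhs_right_gt | exact: nbhs_right_lt].
  have tI : t \in `]0, e[ by rewrite in_itv/= t0 te.
  have sI : s \in `]0, e[ by rewrite in_itv/= s0 (lt_trans st te).
  exact: psi_mono tI sI (ltW st).
near=> t => j.
have /psi_le0 : 0 < t < e.
  by apply/andP; split; near: t; [exact: nbhs_right_gt | exact: nbhs_right_lt].
rewrite pmulr_rle0 ?expR_gt0// => St0.
apply/eqP; rewrite -normr_le0 (le_trans (yS j t))// -sqrtr0.
exact: ler_wsqrtr.
Unshelve. all: by end_near. Qed.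

(** * Derivatives relative to an interval *)

Lemma cvg_rowP {R : realType} {n : nat} {T : Type} {F : set_system T}
    {FF : Filter F} (f : T -> 'rV[R]_n) (v : 'rV[R]_n) :
  f @ F --> v <-> forall j, (fun t => f t 0 j) @ F --> v 0 j.
Proof.
split=> [fv j A Aj|H A [P PN PA]].
  pose P (i : 'I_1) k := if k == j then A else setT.
  apply: (fv (fun w => A (w 0 j))); exists P => [i k|w /(_ 0 j)]; last by rewrite /P eqxx.
  rewrite ord1 /P; case: eqP => [->//|_]; exact: filterT.
suff : \forall t \near F, forall j, P 0 j (f t 0 j).
  apply: (@filterS _ F _) => t Ht; apply: PA => i j; rewrite ord1; exact: Ht.
apply: (@filter_forall _ _ (fun j t => P 0 j (f t 0 j)) F _) => j.
exact: H (PN 0 j).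
Qed.

Lemma cvg_within_intro {T U : Type} (f : T -> U) (F : set_system T)
    {FF : Filter F} (G : set_system U) (I : set U) :
  f @ F `=>` G -> (\forall t \near F, I (f t)) -> f @ F `=>` within I G.
Proof.
move=> fG fI A GA.
have fA : \forall t \near F, I (f t) -> A (f t) := fG _ GA.
have : \forall t \near F, A (f t) by apply: filterS2 fI fA => t It; exact.
by [].
Qed.

Lemma near_withinT {T : Type} (F : set_system T) {FF : Filter F}
    (D P : set T) : D `<=` P -> \forall t \near within D F, P t.
Proof. by move=> DP; rewrite near_withinE; apply: nearW => t; exact: DP. Qed.

Lemma cvg_proportional {R : realType} {T : Type} {F : set_system T}
    {FF : Filter F} (f g : T -> R) (k l : R) :
  f @ F --> l -> (forall t, g t = k * f t) -> g @ F --> k * l.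
Proof.
by move=> fl /funext ->; apply: cvgM fl; exact: cvg_cst.
Qed.

Section DerivWithin.
Context {R : realType} {n : nat}.
Implicit Types (I : set R) (c : R -> 'rV[R]_n).

Lemma has_deriv_withinP I c t v : has_deriv_within I c t v <->
  forall j, (fun s => (s - t)^-1 * (c s 0 j - c t 0 j)) @ within I t^' --> v 0 j.
Proof.
rewrite /has_deriv_within; split.
  move/cvg_rowP => H j; apply: cvg_trans (H j).
  by apply: near_eq_cvg; apply: nearW => s; rewrite !mxE.
move=> H; apply/cvg_rowP => j; apply: cvg_trans (H j).
by apply: near_eq_cvg; apply: nearW => s; rewrite !mxE.
Qed.

Lemma has_deriv_withinZ I c t v (k : R) : has_deriv_within I c t v ->
  has_deriv_within I (fun s => k *: c s) t (k *: v).
Proof.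
move=> /has_deriv_withinP H; apply/has_deriv_withinP => j.
rewrite [_ 0 j in X in _ --> X]mxE; apply: (cvg_proportional (H j)) => s.
by rewrite !mxE; ring.
Qed.

(** The difference quotient at [s] of the rescaled curve is [k] times that of [c]
    at [k * s], and [s |-> k * s] maps punctured neighbourhoods to punctured
    neighbourhoods, unless [k = 0]: then the rescaled curve is constant. *)
Lemma has_deriv_within_rescale I J c t v (k : R) :
  (forall s, J s -> I (k * s)) -> has_deriv_within I c (k * t) v ->
  has_deriv_within J (fun s => c (k * s)) t (k *: v).
Proof.
move=> JI; have [->|k0] := eqVneq k 0.
  move=> _; rewrite scale0r /has_deriv_within.
  rewrite (_ : (fun s => _) = cst 0); first exact: cvg_cst.
  by apply/funext => s; rewrite !mul0r subrr scaler0.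
move=> /has_deriv_withinP H; apply/has_deriv_withinP => j.
rewrite [_ 0 j in X in _ --> X]mxE.
have sub : *%R k @ within J t^' `=>` within I (k * t)^'.
  apply: cvg_within_intro; last by apply: near_withinT => s; exact: JI.
  apply: cvg_within_filter; apply: cvg_within_intro.
    by apply: cvg_within_filter; apply: cvgM; [exact: cvg_cst|exact: cvg_id].
  by apply: near_withinT => s; apply: contra_neq => /(mulfI k0).
apply: (cvg_proportional (cvg_comp _ _ sub (H j))) => s /=.
by rewrite -mulrBr invfM !mulrA divff// mul1r.
Qed.

Lemma has_deriv_within_right I c v : (\forall t \near (0 : R)^'+, I t) ->
  has_deriv_within I c 0 v ->
  forall j, (fun s => s^-1 * (c s 0 j - c 0 0 j)) @ (0 : R)^'+ --> v 0 j.
Proof.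
move=> nI /has_deriv_withinP H j.
have sub : (0 : R)^'+ `=>` within I 0^'.
  apply: (@cvg_within_intro _ _ id (0 : R)^'+ _ 0^' I) => //.
  apply: (@cvg_within_intro _ _ id (0 : R)^'+ _ (nbhs 0)); first exact: cvg_within.
  exact: nbhs_right_neq.
apply: cvg_trans (cvg_trans (cvg_app _ sub) (H j)).
by apply: near_eq_cvg; apply: nearW => s; rewrite subr0.
Qed.

Lemma has_deriv_within_right_cvg I c v : (\forall t \near (0 : R)^'+, I t) ->
  has_deriv_within I c 0 v ->
  forall j, (fun s => c s 0 j) @ (0 : R)^'+ --> c 0 0 j.
Proof.
move=> nI /(has_deriv_within_right nI) H j.
have s0 : id @ (0 : R)^'+ --> (0 : R) by apply: cvg_at_right_filter; exact: cvg_id.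
have E : (fun s => s * (s^-1 * (c s 0 j - c 0 0 j)) + c 0 0 j) @ (0 : R)^'+
    --> 0 * v 0 j + c 0 0 j.
  by apply: cvgD; [exact: cvgM s0 (H j) | exact: cvg_cst].
rewrite mul0r add0r in E; apply: cvg_trans E; apply: near_eq_cvg.
apply: filterS (nbhs_right_gt 0) => s s_gt0 /=.
by rewrite mulrA divff ?gt_eqF// mul1r subrK.
Qed.

Lemma has_deriv_within_unique I c v w : (\forall t \near (0 : R)^'+, I t) ->
  has_deriv_within I c 0 v -> has_deriv_within I c 0 w -> v = w.
Proof.
move=> nI /(has_deriv_within_right nI) Hv /(has_deriv_within_right nI) Hw.
apply/rowP => j; exact: cvg_unique (Hv j) (Hw j).
Qed.

(** At an interior point the restriction to [I] disappears, and what remains is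
    the two-sided derivative to which the mean value theorem applies. *)
Lemma has_deriv_within_is_derive I c t v : (\forall s \near t, I s) ->
  has_deriv_within I c t v ->
  forall j, is_derive t 1 (fun s => c s 0 j) (v 0 j).
Proof.
move=> nI /has_deriv_withinP H j.
have lim : h^-1 *: (((fun s => c s 0 j) \o shift t) (h *: (1 : R)) - c t 0 j)
    @[h --> (0 : R)^'] --> v 0 j.
  have ct : shift t @ (0 : R)^' `=>` nbhs t.
    have : shift t @ (0 : R)^' `=>` nbhs (0 + t).
      by apply: cvg_within_filter; apply: cvgD; [exact: cvg_id|exact: cvg_cst].
    by rewrite add0r.
  have sub : shift t @ (0 : R)^' `=>` within I t^'.
    apply: cvg_within_intro; last exact: ct nI.
    apply: cvg_within_intro => //; apply: near_withinT => h.
    by apply: contra_neq => /(canRL (addrK t)) ->; rewrite subrr.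
  apply: cvg_trans (cvg_comp _ _ sub (H j)).
  apply: near_eq_cvg; apply: nearW => h /=.
  by rewrite addrK /GRing.scale/= mulr1.
by split; [apply/cvg_ex; exists (v 0 j) | exact: cvg_lim lim].
Qed.

End DerivWithin.

(** * Local uniqueness and rescaling of geodesics *)

Section Geodesics.
Context {R : realType} {n : nat} {M : riemannian R n}.

Lemma gmx_unit (a : aidx M) x : cimg (atlas a) x -> gmx a x \in unitmx.
Proof.
move=> ax; rewrite unitmxE unitfE; apply/negP => /det0P[v v0 vg].
by have := gmx_posdef ax v0; rewrite vg mul0mx mxE ltxx.
Qed.

(** Christoffel symbols are polynomials in the entries of the inverse of the
    metric and in its first partial derivatives; the metric being smooth, all of
    these inherit closeness from the base points. *)
Lemma lipclose_christoffel {T : Type} {G : set_system T} {FG : Filter G}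
    (D : T -> R) (D0 : forall t, 0 <= D t) (a : aidx M) x (c1 c2 : T -> 'rV[R]_n) :
  cimg (atlas a) x -> c1 @ G --> x -> c2 @ G --> x ->
  (\forall t \near G, forall i, `|c1 t 0 i - c2 t 0 i| <= D t) ->
  forall k i j, lipclose (F := G) D (christoffel a x k i j)
    (fun t => christoffel a (c1 t) k i j) (fun t => christoffel a (c2 t) k i j).
Proof.
move=> ax h1 h2 hD k i j.
have C1 (F : 'rV[R]_n -> R) : Ck_on 1 (cimg (atlas a)) F ->
    lipclose (F := G) D (F x) (F \o c1) (F \o c2).
  move=> F1; exact: lipclose_C1 (@cimg_open _ _ _ _) ax F1 h1 h2 hD.
have dC1 l p q : lipclose (F := G) D (partial l (fun y => gmx a y p q) x)
    (fun t => partial l (fun y => gmx a y p q) (c1 t))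
    (fun t => partial l (fun y => gmx a y p q) (c2 t)).
  by apply: (C1 (partial l _)); exact: ((gmx_smooth a p q 2).2 l).2.
apply: lipcloseM => //; first exact: lipclose_cst.
apply: lipclose_sum => // l _; apply: lipcloseM => //.
  apply: lipclose_invmx => //; first exact: gmx_unit.
  by move=> p q; exact: C1 (gmx_smooth a p q 1).
by apply: lipcloseB => //; apply: lipcloseD.
Qed.

(** The acceleration that the geodesic equation prescribes at position [x] and
    velocity [v]. *)
Definition geodesic_rhs (a : aidx M) (x v : 'rV[R]_n) : 'rV[R]_n :=
  \row_k - \sum_(i < n) \sum_(j < n) christoffel a x k i j * v 0 i * v 0 j.

(** Agreement of the germs at [0+] is all that directional derivatives need, so
    that everything takes place in a single chart around [p].  The initial
    velocities agree because both are the coordinates of [X]. *)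
Lemma geodesic_unique_germ (p : M) (X : tvec p) (I1 I2 : set R) (g1 g2 : R -> M) :
  I1 0 -> I2 0 ->
  (\forall t \near (0 : R)^'+, I1 t) -> (\forall t \near (0 : R)^'+, I2 t) ->
  geodesic_on I1 g1 -> starts_at I1 g1 X ->
  geodesic_on I2 g2 -> starts_at I2 g2 X ->
  \forall t \near (0 : R)^'+, g1 t = g2 t.
Proof.
move=> I10 I20 nI1 nI2 geo1 st1 geo2 st2.
have [a pa] := atlas_cover p.
pose x := cmap (atlas a) p.
have germ I g : I 0 -> (\forall t \near (0 : R)^'+, I t) ->
    geodesic_on I g -> starts_at I g X -> exists V : R -> 'rV[R]_n,
  let c := cmap (atlas a) \o g in
  [/\ (\forall t \near (0 : R)^'+, cdom (atlas a) (g t)),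
      c @ (0 : R)^'+ --> x,
      (forall k, (fun t => V t 0 k) @ (0 : R)^'+ --> tcoord X a 0 k) &
      \forall t \near (0 : R)^'+, forall k,
        is_derive t (1 : R) (fun s => c s 0 k) (V t 0 k) /\
        is_derive t (1 : R) (fun s => V s 0 k) (geodesic_rhs a (c t) (V t) 0 k)].
  move=> I0 nI [cg [V HV]] [g0 gX]; exists (V a) => c.
  have g_p : g @ (0 : R)^'+ --> p.
    have : g @ within I (nbhs 0) --> g 0 by exact: (subspace_continuousP _ _).1 cg 0 I0.
    rewrite g0; apply: cvg_trans; apply: cvg_app.
    apply: (@cvg_within_intro _ _ id (0 : R)^'+ _ (nbhs 0) I) => //.
    exact: cvg_within.
  have ng : \forall t \near (0 : R)^'+, cdom (atlas a) (g t).
    apply: g_p; apply: open_nbhs_nbhs; split=> //; exact: cdom_open.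
  have [|dc dV] := HV a 0 I0; first by rewrite g0.
  have V0 : V a 0 = tcoord X a by apply: has_deriv_within_unique nI dc (gX _ pa).
  split=> //.
  - apply: cvg_comp g_p _; exact: cmap_continuous.
  - by move=> k; rewrite -V0; exact: has_deriv_within_right_cvg nI dV k.
  - have [e e0 He] := near_at_right0 (filterI nI ng).
    near=> t => k.
    have te : 0 < t < e.
      by apply/andP; split; near: t; [exact: nbhs_right_gt|exact: nbhs_right_lt].
    have nt : \forall s \near t, I s.
      have : \forall s \near t, s \in `]0, e[ by apply: near_in_itvoo; rewrite in_itv.
      by apply: filterS => s; rewrite in_itv => /He[].
    have [It at_] := He _ te.
    have [dct dVt] := HV a t It at_.
    split; first exact: has_deriv_within_is_derive nt dct k.
    exact: has_deriv_within_is_derive nt dVt k.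
have [V1 [n1 c1x V1x d1]] := germ I1 g1 I10 nI1 geo1 st1.
have [V2 [n2 c2x V2x d2]] := germ I2 g2 I20 nI2 geo2 st2.
set c1 := _ \o g1 in c1x d1; set c2 := _ \o g2 in c2x d2.
(* [y] is the difference of the two states: positions, then velocities *)
pose y (j : 'I_n + 'I_n) t := match j with
  | inl k => c1 t 0 k - c2 t 0 k | inr k => V1 t 0 k - V2 t 0 k end.
pose dy (j : 'I_n + 'I_n) t := match j with
  | inl k => V1 t 0 k - V2 t 0 k
  | inr k => geodesic_rhs a (c1 t) (V1 t) 0 k - geodesic_rhs a (c2 t) (V2 t) 0 k
  end.
pose D t := Num.sqrt (\sum_j y j t ^+ 2).
have D0 t : 0 <= D t by exact: sqrtr_ge0.
have yD j t : `|y j t| <= D t.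
  rewrite -sqrtr_sqr ler_wsqrtr// (bigD1 j)//= lerDl.
  by apply: sumr_ge0 => i _; exact: sqr_ge0.
have ax : cimg (atlas a) x by exact: cmap_img.
have Vclose k : lipclose (F := (0 : R)^'+) D (tcoord X a 0 k)
    (fun t => V1 t 0 k) (fun t => V2 t 0 k).
  split=> //; exists 1 => //; apply: nearW => t; rewrite mul1r.
  exact: (yD (inr k)).
have rclose k : lipclose (F := (0 : R)^'+) D (geodesic_rhs a x (tcoord X a) 0 k)
    (fun t => geodesic_rhs a (c1 t) (V1 t) 0 k)
    (fun t => geodesic_rhs a (c2 t) (V2 t) 0 k).
  apply: eq_lipclose; [by rewrite mxE|by move=> t; rewrite mxE|by move=> t; rewrite mxE|].
  apply: lipcloseN; apply: lipclose_sum => // i _; apply: lipclose_sum => // j _.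
  apply: lipcloseM => //; apply: lipcloseM => //.
  apply: lipclose_christoffel => //; apply: nearW => t k'.
  exact: (yD (inl k')).
(* each component of [y'] has its own constant; their sum serves for all *)
have [K HK] : {K : 'I_n + 'I_n -> R & forall j, 0 <= K j /\
    \forall t \near (0 : R)^'+, `|dy j t| <= K j * D t}.
  apply: (@choice _ _ (fun j k => 0 <= k /\
    \forall t \near (0 : R)^'+, `|dy j t| <= k * D t)) => -[k|k].
    by have [_ _ [K K0 HK]] := Vclose k; exists K.
  by have [_ _ [K K0 HK]] := rclose k; exists K.
have y0 : \forall t \near (0 : R)^'+, forall j, y j t = 0.
  apply: (@gronwall_zero _ _ y dy (\sum_j K j)) => [[k|k]|].
  - have : y (inl k) @ (0 : R)^'+ --> x 0 k - x 0 k.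
      exact: cvgB ((cvg_rowP c1 x).1 c1x k) ((cvg_rowP c2 x).1 c2x k).
    by rewrite subrr.
  - have : y (inr k) @ (0 : R)^'+ --> tcoord X a 0 k - tcoord X a 0 k.
      exact: cvgB (V1x k) (V2x k).
    by rewrite subrr.
  - have nK : \forall t \near (0 : R)^'+, forall j, `|dy j t| <= K j * D t.
      apply: (@filter_forall _ _ (fun j t => `|dy j t| <= K j * D t)).
      by move=> j; exact: (HK j).2.
    apply: filterS3 nK d1 d2 => t Kt d1t d2t j; split.
      case: j => k.
        exact: is_deriveB (d1t k).1 (d2t k).1.
      exact: is_deriveB (d1t k).2 (d2t k).2.
    apply: le_trans (Kt j) _; rewrite ler_wpM2r// (bigD1 j)//= lerDl.
    by apply: sumr_ge0 => i _; exact: (HK i).1.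
apply: filterS3 y0 n1 n2 => t yt a1 a2.
rewrite -(cmapK a1) -(cmapK a2); congr cinv.
by apply/rowP => k; apply/eqP; rewrite -subr_eq0; apply/eqP; exact: (yt (inl k)).
Unshelve. all: by end_near. Qed.

(** Velocities are multiplied by [k] and accelerations by [k ^ 2], which matches
    the fact that the geodesic equation is quadratic in the velocity. *)
Lemma geodesic_rescale (I J : set R) (g : R -> M) (k : R) :
  (forall s, J s -> I (k * s)) -> geodesic_on I g ->
  geodesic_on J (fun s => g (k * s)).
Proof.
move=> JI [cg [V HV]]; split.
  apply/subspace_continuousP => s Js.
  have cks : g @ within I (nbhs (k * s)) --> g (k * s).
    exact: (subspace_continuousP _ _).1 cg _ (JI _ Js).
  have sub : *%R k @ within J (nbhs s) `=>` within I (nbhs (k * s)).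
    apply: cvg_within_intro; last by rewrite near_withinE; near=> u; exact: JI.
    by apply: cvg_within_filter; apply: cvgM; [exact: cvg_cst|exact: cvg_id].
  exact: cvg_comp sub cks.
exists (fun a s => k *: V a (k * s)) => a t Jt at_.
have [dc dV] := HV a (k * t) (JI _ Jt) at_.
split; first exact: (has_deriv_within_rescale JI dc).
have := has_deriv_withinZ (k := k) (has_deriv_within_rescale JI dV).
congr has_deriv_within; apply/rowP => l; rewrite !mxE.
rewrite !mulrN !mulr_sumr; congr (- _); apply: eq_bigr => i _.
rewrite !mulr_sumr; apply: eq_bigr => j _; rewrite !mxE; ring.
Unshelve. all: by end_near. Qed.

Lemma starts_at_rescale (I J : set R) (g : R -> M) (p : M) (X : tvec p) (k : R) :
  (forall s, J s -> I (k * s)) -> starts_at I g X ->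
  starts_at J (fun s => g (k * s)) (tscale k X).
Proof.
move=> JI [g0 gX]; split; first by rewrite mulr0.
move=> a pa; apply: (has_deriv_within_rescale (c := cmap (atlas a) \o g) JI).
by rewrite mulr0; exact: gX.
Qed.

Lemma dir_geodesic_near (E : set M) x (X : tvec x) I g :
  dir_geodesic E X I g -> \forall t \near (0 : R)^'+, I t.
Proof.
move=> [Iitv I0 [s Is s0] _ _]; near=> t; apply: (Iitv 0 s) => //.
by apply/andP; split; near: t; [exact: nbhs_right_ge|exact: nbhs_right_le].
Unshelve. all: by end_near. Qed.

Lemma dir_geodesic_germ (E : set M) x (X : tvec x) I1 I2 g1 g2 :
  dir_geodesic E X I1 g1 -> dir_geodesic E X I2 g2 ->
  \forall t \near (0 : R)^'+, g1 t = g2 t.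
Proof.
move=> d1 d2; have n1 := dir_geodesic_near d1; have n2 := dir_geodesic_near d2.
case: d1 d2 => _ I10 _ [geo1 st1] _ [_ I20 _ [geo2 st2] _].
exact: geodesic_unique_germ geo1 st1 geo2 st2.
Qed.

(** As [I] contains some [(0, e)], the filter does not depend on [I]: limits along
    geodesics with different domains can be compared. *)
Lemma within_dir_geodesic (E : set M) x (X : tvec x) I g :
  dir_geodesic E X I g -> within I (0 : R)^'+ = (0 : R)^'+.
Proof.
move=> /dir_geodesic_near nI; apply/funext => A; apply/propext; split.
  by move=> H; apply: filterS2 nI H => t It; exact.
by apply: filterS => t At _.
Qed.

End Geodesics.

(** * Intervals in centre and half-width coordinates *)

(* the unqualified name is otherwise a shift operator of normed modules *)
Local Notation center := Defs.center.

Section IntervalCoordinates.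
Context {R : realType}.
Implicit Types (A B : itvl R) (k : R).

Lemma itvl_eq A B : center A = center B -> hwidth A = hwidth B -> A = B.
Proof.
rewrite /Defs.center /hwidth /lo /hi => cAB wAB; apply: val_inj.
case: (val A) (val B) cAB wAB => a b [c d] /= cAB wAB.
by congr pair; lra.
Qed.

Lemma hwidth_ge0 A : 0 <= hwidth A.
Proof. by rewrite divr_ge0// subr_ge0; exact: (valP A). Qed.

Lemma center_cw (c w : R) (w0 : 0 <= w) : center (cw c w0) = c.
Proof. by rewrite /Defs.center /lo /hi /=; lra. Qed.

Lemma hwidth_cw (c w : R) (w0 : 0 <= w) : hwidth (cw c w0) = w.
Proof. by rewrite /hwidth /lo /hi /=; lra. Qed.

Lemma center_iscale k A : 0 <= k -> center (iscale k A) = k * center A.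
Proof. by move=> k0; rewrite /Defs.center {1 2}/lo {1 2}/hi /= k0 mulrA mulrDr. Qed.

Lemma hwidth_iscale k A : 0 <= k -> hwidth (iscale k A) = k * hwidth A.
Proof. by move=> k0; rewrite /hwidth {1 2}/lo {1 2}/hi /= k0 mulrA mulrBr. Qed.

Lemma center_gHsub A B : center (gHsub A B) = center A - center B.
Proof. by rewrite /Defs.center {1}/lo {1}/hi /= addr_min_max; lra. Qed.

Lemma hwidth_gHsub A B : hwidth (gHsub A B) = `|hwidth A - hwidth B|.
Proof.
rewrite /hwidth {1}/lo {1}/hi /=; case: leP => h; case: ler0P => h'; lra.
Qed.

(** If [c] and [w] are the differences of the centres and of the half-widths, the
    end points differ by [c - w] and [c + w], and
    [max |c - w| |c + w| = |c| + |w|]. *)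
Lemma dHE A B : dH A B = `|center A - center B| + `|hwidth A - hwidth B|.
Proof.
rewrite /dH /Defs.center /hwidth.
by case: ler0P => h1; case: ler0P => h2; case: leP => h3; case: ler0P => h4;
  case: ler0P => h5; lra.
Qed.

Lemma cvg_itvlP {F : set_system R} {FF : Filter F} (Q : R -> itvl R) A :
  cvg_itvl F Q A <->
  (fun s => center (Q s)) @ F --> center A /\
  (fun s => hwidth (Q s)) @ F --> hwidth A.
Proof.
rewrite /cvg_itvl; split.
  move=> /cvgrPdist_le H; split; apply/cvgrPdist_le => e /H;
    apply: filterS => s; rewrite sub0r normrN ger0_norm ?dHE ?addr_ge0//;
    apply: le_trans; rewrite distrC; [rewrite lerDl|rewrite lerDr]; exact: normr_ge0.
move=> [cQ wQ].
have : (fun s => `|center (Q s) - center A| + `|hwidth (Q s) - hwidth A|) @ F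
    --> `|center A - center A| + `|hwidth A - hwidth A|.
  by apply: cvgD; apply: cvg_norm; apply: cvgB => //; exact: cvg_cst.
rewrite !subrr normr0 addr0; apply: cvg_trans; apply: near_eq_cvg.
by apply: nearW => s; rewrite dHE.
Qed.

End IntervalCoordinates.

(** * Directional derivatives *)

Section DirectionalDerivatives.
Context {R : realType} {n : nat} {M : riemannian R n}.
Variable E : set M.
Implicit Types (h : M -> R) (f : M -> itvl R).

Lemma center_gHquot f (x : M) (g : R -> M) s : 0 < s ->
  center (gHquot f x g s) = (fc f (g s) - fc f x) / s.
Proof.
by move=> s0; rewrite center_iscale ?invr_ge0 ?ltW// center_gHsub mulrC.
Qed.

Lemma hwidth_gHquot f (x : M) (g : R -> M) s : 0 < s ->
  hwidth (gHquot f x g s) = `|fw f (g s) - fw f x| / s.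
Proof.
by move=> s0; rewrite hwidth_iscale ?invr_ge0 ?ltW// hwidth_gHsub mulrC.
Qed.

(** Existence of the derivative along one geodesic with initial velocity [X]
    entails its existence, with the same value, along all of them. *)
Lemma has_gHdd_along f x (X : tvec x) I g D : dir_geodesic E X I g ->
  has_gHdd E f X D -> cvg_itvl (within I (0 : R)^'+) (gHquot f x g) D.
Proof.
move=> dg [I' [g' [dg' H]]].
rewrite (within_dir_geodesic dg); rewrite (within_dir_geodesic dg') in H.
apply: cvg_trans H; apply: near_eq_cvg.
by apply: filterS (dir_geodesic_germ dg dg') => t gt; rewrite /gHquot gt.
Qed.

Lemma has_gHdd_unique f x (X : tvec x) D D' :
  has_gHdd E f X D -> has_gHdd E f X D' -> D = D'.
Proof.
move=> [I [g [dg H]]] /(has_gHdd_along dg); move: H.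
rewrite (within_dir_geodesic dg) => /cvg_itvlP[c w] /cvg_itvlP[c' w'].
by apply: itvl_eq; [exact: cvg_unique c c'|exact: cvg_unique w w'].
Qed.

Lemma gHddE f x (X : tvec x) D : has_gHdd E f X D -> gHdd E f X = D.
Proof.
move=> HD; apply: (has_gHdd_unique _ HD).
by apply: (@xgetPex _ _ (has_gHdd E f X)); exists D.
Qed.

Lemma has_dd_unique h x (X : tvec x) d d' :
  has_dd E h X d -> has_dd E h X d' -> d = d'.
Proof.
move=> [I [g [dg H]]] [I' [g' [dg' H']]].
rewrite (within_dir_geodesic dg) in H; rewrite (within_dir_geodesic dg') in H'.
have : (fun s => (h (g s) - h x) / s) @ (0 : R)^'+ --> d'.
  apply: cvg_trans H'; apply: near_eq_cvg.
  by apply: filterS (dir_geodesic_germ dg dg') => t ->.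
exact: cvg_unique H.
Qed.

Lemma ddE h x (X : tvec x) d : has_dd E h X d -> dd E h X = d.
Proof.
move=> Hd; apply: (has_dd_unique _ Hd).
by apply: (@xgetPex _ _ (has_dd E h X)); exists d.
Qed.

Lemma dir_geodesic_rescale x (X : tvec x) I g (k : R) : 0 <= k ->
  dir_geodesic E X I g ->
  dir_geodesic E (tscale k X) [set s | I (k * s)] (fun s => g (k * s)).
Proof.
move=> k0 [Iitv I0 [s0 Is0 s0_gt0] [geo st] gE].
have JI s : [set s | I (k * s)] s -> I (k * s) by [].
split.
- move=> a b Ia Ib c /andP[ac cb]; apply: Iitv Ia Ib _ _.
  by rewrite !ler_wpM2l.
- by rewrite /= mulr0.
- have [->|k_neq0] := eqVneq k 0; first by exists 1; rewrite //= mul0r.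
  exists (k^-1 * s0); first by rewrite /= mulrA divff// mul1r.
  by rewrite mulr_gt0// invr_gt0 lt_def k_neq0.
- by split; [exact: geodesic_rescale JI geo | exact: starts_at_rescale JI st].
- by move=> s /gE.
Qed.

Lemma has_gHdd_tscale f x (X : tvec x) D (k : R) : 0 <= k ->
  has_gHdd E f X D -> has_gHdd E f (tscale k X) (iscale k D).
Proof.
move=> k0 [I [g [dg H]]].
have dg' := dir_geodesic_rescale k0 dg.
exists [set s | I (k * s)], (fun s => g (k * s)); split => //.
rewrite (within_dir_geodesic dg'); rewrite (within_dir_geodesic dg) in H.
have [->|k_neq0] := eqVneq k 0.
  have g0 : g 0 = x by case: dg => _ _ _ [_ []].
  apply/cvg_itvlP; rewrite center_iscale// hwidth_iscale// !mul0r.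
  split; apply: cvg_near_cst; apply: filterS (nbhs_right_gt 0) => s s0.
    by rewrite center_gHquot// mul0r g0 subrr mul0r.
  by rewrite hwidth_gHquot// mul0r g0 subrr normr0 mul0r.
have k_gt0 : 0 < k by rewrite lt_def k_neq0.
have sub : *%R k @ (0 : R)^'+ `=>` (0 : R)^'+.
  apply: cvg_within_intro; last first.
    by apply: filterS (nbhs_right_gt 0) => s s0; rewrite mulr_gt0.
  have : *%R k @ (0 : R)^'+ `=>` nbhs (k * 0).
    by apply: cvg_within_filter; apply: cvgM; [exact: cvg_cst|exact: cvg_id].
  by rewrite mulr0.
have Qk s : 0 < s ->
    iscale k (gHquot f x g (k * s)) = gHquot f x (fun s => g (k * s)) s.
  move=> s0; have ks0 : 0 < k * s by rewrite mulr_gt0.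
  have cancel z : k * (z / (k * s)) = z / s.
    by field; rewrite k_neq0 gt_eqF.
  apply: itvl_eq; first by rewrite center_iscale// !center_gHquot.
  by rewrite hwidth_iscale// !hwidth_gHquot.
move/cvg_itvlP : H => [c w].
apply/cvg_itvlP; rewrite center_iscale// hwidth_iscale//; split.
  apply: cvg_trans (cvg_proportional (cvg_comp _ _ sub c) (fun=> erefl)).
  apply: near_eq_cvg; apply: filterS (nbhs_right_gt 0) => s s0 /=.
  by rewrite -Qk// center_iscale.
apply: cvg_trans (cvg_proportional (cvg_comp _ _ sub w) (fun=> erefl)).
apply: near_eq_cvg; apply: filterS (nbhs_right_gt 0) => s s0 /=.
by rewrite -Qk// hwidth_iscale.
Qed.

(** Convexity at [x0] is applied to the geodesic [u |-> g (t * u)] from [x0] to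
    [g t], at [u = s / t]. *)
Lemma convex_at_slope_mono h (x0 : M) (I : set R) (g : R -> M) :
  is_interval I -> I 0 -> (forall s, I s -> E (g s)) -> geodesic_on I g ->
  g 0 = x0 -> convex_at E x0 h ->
  forall s t, I t -> 0 < s -> s < t ->
    (h (g s) - h x0) / s <= (h (g t) - h x0) / t.
Proof.
move=> Iitv I0 gE geo g0 hconv s t It s0 st.
have t0 : 0 < t := lt_trans s0 st.
have geo01 : geodesic_from_to x0 (g t) (fun u => g (t * u)).
  split; rewrite ?mulr0 ?mulr1//; apply: geodesic_rescale geo => u.
  rewrite /= in_itv/= => /andP[u0 u1]; apply: Iitv I0 It _ _.
  by rewrite mulr_ge0 ?(ltW t0)//= ger_pMr.
have := hconv _ _ (gE _ It) geo01 (s / t).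
rewrite divr_gt0//= ltr_pdivrMr// mul1r => /(_ st).
rewrite mulrCA divff ?gt_eqF// mulr1 => H.
rewrite ler_pdivrMr// mulrAC -mulrA.
have -> : (h (g t) - h x0) * (s / t) = (1 - s / t) * h x0 + s / t * h (g t) - h x0 by ring.
by rewrite lerB.
Qed.

End DirectionalDerivatives.

(** * Monotonicity of the gH-quotient and the gH-derivative *)

Theorem theorem4p1 (R : realType) (n : nat) (M : riemannian R n)
    (Mcomplete : geodesically_complete M)
    (E : set M) (x0 : M) (Estar : star_shaped_at E x0)
    (f : M -> itvl R)
    (I : set R) (g : R -> M) (X : tvec x0)
    (Iitv : is_interval I) (I0 : I 0)
    (gE : forall s, I s -> E (g s))
    (ggeo : geodesic_on I g) (gX : starts_at I g X)
    (fw_mono : forall s t, I s -> I t -> 0 <= s -> s < t ->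
       fw f (g s) <= fw f (g t))
    (fconv : cw_convex_at E x0 f) :
  nondecreasing_itvl_on (I `&` [set s | 0 < s]) (gHquot f x0 g)
  /\
  ((exists2 s, I s & 0 < s) -> gHdd_exists E f X ->
    (cvg_itvl (within I 0^'+) (gHquot f x0 g) (gHdd E f X) /\
     dd_exists E (fc f) X /\ dd_exists E (fw f) X /\
     exists w_ge0 : 0 <= dd E (fw f) X,
       gHdd E f X = cw (dd E (fc f) X) w_ge0)
    /\
    (forall Y : tvec x0, tangent_set E Y -> gHdd_exists E f Y ->
       forall lambda : R, 0 <= lambda ->
         tangent_set E (tscale lambda Y) /\
         gHdd_exists E f (tscale lambda Y) /\
         gHdd E f (tscale lambda Y) = iscale lambda (gHdd E f Y))).
Proof.
have g0 : g 0 = x0 by case: gX.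
have fw_ge s : I s -> 0 < s -> 0 <= fw f (g s) - fw f x0.
  by move=> Is s0; rewrite subr_ge0 -g0; exact: fw_mono.
have widthQ s : I s -> 0 < s ->
    hwidth (gHquot f x0 g s) = (fw f (g s) - fw f x0) / s.
  by move=> Is s0; rewrite hwidth_gHquot// ger0_norm// fw_ge.
split.
  move=> s t [Is /= s0] [It /= t0] st; rewrite /Defs.le_min.
  rewrite !center_gHquot// !widthQ//.
  have c_mono := convex_at_slope_mono Iitv I0 gE ggeo g0 fconv.1 It s0 st.
  have w_mono := convex_at_slope_mono Iitv I0 gE ggeo g0 fconv.2 It s0 st.
  by move: c_mono; rewrite le_eqVlt => /orP[/eqP|]; [right|left].
move=> Ipos [D HD]; split.
  have dg : dir_geodesic E X I g by [].
  have QD := has_gHdd_along dg HD.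
  rewrite (gHddE HD); split=> //.
  move: (QD); rewrite (within_dir_geodesic dg) => /cvg_itvlP[cQ wQ].
  have Hc : has_dd E (fc f) X (center D).
    exists I, g; split=> //; rewrite (within_dir_geodesic dg).
    apply: cvg_trans cQ; apply: near_eq_cvg.
    by apply: filterS (nbhs_right_gt 0) => s s0; rewrite center_gHquot.
  have Hw : has_dd E (fw f) X (hwidth D).
    exists I, g; split=> //; rewrite (within_dir_geodesic dg).
    apply: cvg_trans wQ; apply: near_eq_cvg.
    by apply: filterS2 (dir_geodesic_near dg) (nbhs_right_gt 0) => s Is s0;
      rewrite widthQ.
  split; first by exists (center D).
  split; first by exists (hwidth D).
  have w_ge0 : 0 <= dd E (fw f) X by rewrite (ddE Hw) hwidth_ge0.
  exists w_ge0; apply: itvl_eq; first by rewrite center_cw (ddE Hc).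
  by rewrite hwidth_cw (ddE Hw).
move=> Y [J [y dy]] [D' HD'] k k0.
have HkD := has_gHdd_tscale k0 HD'.
split; first by exists [set s | J (k * s)], (fun s => y (k * s));
  exact: dir_geodesic_rescale.
split; first by exists (iscale k D').
by rewrite (gHddE HkD) (gHddE HD').
Qed.
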